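(* Let $G$ be a group, $K$ a field, and let $\mathcal{A}$ be the subalgebra of $K_{\rm par}(G)$ generated by the elements $\tilde\varepsilon_g=\tilde\pi(g)\tilde\pi(g^{-1})=[g][g^{-1}]$ $(g\in G)$, where $\tilde\pi:G\ni g\mapsto[g]\in K_{\rm par}(G)$. Let $\alpha^{\tilde\pi}$ be the partial action of $G$ on $\mathcal{A}$ associated to the partial representation $\tilde\pi$. Then the homomorphism $$\phi_{\tilde\pi}:\mathcal{A}\rtimes_{\alpha^{\tilde\pi}}G\to K_{\rm par}(G),\qquad \phi_{\tilde\pi}\Big(\sum_{g\in G}a_g\delta_g\Big)=\sum_{g\in G}a_g\tilde\pi(g),$$ associated to $\tilde\pi$ is an isomorphism.
   Context: The partial group algebra $K_{\rm par}(G)$ is the semigroup algebra $KS(G)$, where $S(G)$ is the universal semigroup generated by symbols $\{[g]:g\in G\}$ subject to the relations $[g^{-1}][g][h]=[g^{-1}][gh]$, $[g][h][h^{-1}]=[gh][h^{-1}]$ $(g,h\in G)$ and $[1]=1$, where $1$ also denotes the identity element of $S(G)$. A partial representation of $G$ into a unital $K$-algebra $\mathcal{B}$ is a map $\pi:G\to\mathcal{B}$ with $\pi(1)=1$ and, for all $g,h\in G$, $\pi(g)\pi(h)\pi(h^{-1})=\pi(gh)\pi(h^{-1})$ and $\pi(g^{-1})\pi(g)\pi(h)=\pi(g^{-1})\pi(gh)$. The map $\tilde\pi$ is a partial representation. A partial action $\alpha$ of $G$ on an algebra $\mathcal{A}$ is a collection of two-sided ideals $\mathcal{D}_g$ of $\mathcal{A}$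 and algebra isomorphisms $\alpha_g:\mathcal{D}_{g^{-1}}\to\mathcal{D}_g$ $(g\in G)$ such that $\mathcal{D}_1=\mathcal{A}$, $\alpha_1=\mathrm{id}$; $\mathcal{D}_{(gh)^{-1}}\supseteq\alpha_h^{-1}(\mathcal{D}_h\cap\mathcal{D}_{g^{-1}})$; and $\alpha_g\circ\alpha_h(x)=\alpha_{gh}(x)$ for $x\in\alpha_h^{-1}(\mathcal{D}_h\cap\mathcal{D}_{g^{-1}})$. The skew group ring $\mathcal{A}\rtimes_\alpha G$ is the set of finite formal sums $\sum_g a_g\delta_g$, $a_g\in\mathcal{D}_g$, with the obvious addition and multiplication determined by $(a_g\delta_g)(b_h\delta_h)=\alpha_g(\alpha_{g^{-1}}(a_g)b_h)\delta_{gh}$. For a partial representation $\pi:G\to\mathcal{B}$, the elements $\varepsilon_g=\pi(g)\pi(g^{-1})$ are commuting idempotents. Let $\mathcal{A}$ be the subalgebra of $\mathcal{B}$ generated by all $\varepsilon_g$ and put $\mathcal{D}_g=\varepsilon_g\mathcal{A}$. The maps $\alpha^\pi_g:\mathcal{D}_{g^{-1}}\to\mathcal{D}_g$, $\alpha^\pi_g(a)=\pi(g)a\pi(g^{-1})$, form a partial action $\alpha^\pi$ of $G$ on $\mathcal{A}$, and $\phi_\pi:\mathcal{A}\rtimes_{\alpha^\pi}G\to\mathcal{B}$, $\sum_g a_g\delta_g\mapsto\sum_g a_g\pi(g)$, is an algebra homomorphism. *)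

(* Defs.v *)
From HB Require Import structures.
From mathcomp Require Import all_boot all_algebra.
From mathcomp Require Import boolp classical_sets functions.
From mathcomp Require Import finmap monalg.

Set Implicit Arguments.
Unset Strict Implicit.
Unset Printing Implicit Defensive.

Import GRing.Theory.
Local Open Scope quotient_scope.
Local Open Scope classical_set_scope.
Local Open Scope ring_scope.

Section ExelMonoid.
Variable G : groupType.

(* Defining relations of the universal semigroup S(G), called [exel] below. A
   word [:: g1; ...; gn] stands for the product [g1]...[gn], and [::] for the
   identity of S(G). *)
Inductive exel_rel : seq G -> seq G -> Prop :=
  | exel_relV (g h : G) :
      exel_rel [:: g^-1; g; h]%g [:: g^-1; g * h]%g
  | exel_relM (g h : G) :
      exel_rel [:: g; h; h^-1]%g [:: g * h; h^-1]%g
  | exel_rel1 : exel_rel [:: 1%g] [::]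
  | exel_rel_cat u u' v v' :
      exel_rel u u' -> exel_rel v v' -> exel_rel (u ++ v) (u' ++ v')
  | exel_rel_refl u : exel_rel u u
  | exel_rel_sym u v : exel_rel u v -> exel_rel v u
  | exel_rel_trans u v w : exel_rel u v -> exel_rel v w -> exel_rel u w.

Definition exel_eq : rel (seq G) := fun u v => `[< exel_rel u v >].

Fact exel_eq_refl : reflexive exel_eq.
Proof. by move=> u; apply/asboolP/exel_rel_refl. Qed.

Fact exel_eq_sym : symmetric exel_eq.
Proof.
by move=> u v; apply/asboolP/asboolP; apply: exel_rel_sym.
Qed.

Fact exel_eq_trans : transitive exel_eq.
Proof.
by move=> v u w /asboolP uv /asboolP vw; apply/asboolP/(exel_rel_trans uv).
Qed.

Canonical exel_equiv := EquivRel exel_eq exel_eq_refl exel_eq_sym exel_eq_trans.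

Definition exel : Type := {eq_quot exel_equiv}.
HB.instance Definition _ := Choice.on exel.
HB.instance Definition _ := EqQuotient.on exel.

Definition exel_one : exel := \pi_exel [::].
Definition exel_mul (x y : exel) : exel := \pi_exel (repr x ++ repr y).
Definition exel_gen (g : G) : exel := \pi_exel [:: g].

Lemma exel_piP u v : \pi_exel u = \pi_exel v <-> exel_rel u v.
Proof. by split=> [/eqmodP/asboolP //|uv]; apply/eqmodP/asboolP. Qed.

Lemma exel_mul_pi u v : exel_mul (\pi_exel u) (\pi_exel v) = \pi_exel (u ++ v).
Proof. by apply/exel_piP/exel_rel_cat; apply/exel_piP; rewrite reprK. Qed.

Fact exel_mulA : associative exel_mul.
Proof.
move=> x y z; rewrite -[x]reprK -[y]reprK -[z]reprK.
rewrite (exel_mul_pi (repr y) (repr z)) (exel_mul_pi (repr x) (repr y)).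
by rewrite !exel_mul_pi catA.
Qed.

Fact exel_mul1m : left_id exel_one exel_mul.
Proof. by move=> x; rewrite -[x]reprK exel_mul_pi. Qed.

Fact exel_mulm1 : right_id exel_one exel_mul.
Proof. by move=> x; rewrite -[x]reprK exel_mul_pi cats0. Qed.

(* S(G) has no nontrivial units; this is required by [monomType]. *)
Lemma exel_rel_all1 u v : exel_rel u v -> all (pred1 1%g) u = all (pred1 1%g) v.
Proof.
elim=> {u v} [g h|g h||u u' v v' _ eu _ ev|//|u v _ -> //|u v w _ -> //] /=.
- by rewrite invg_eq1 !andbT; case: eqVneq => //= ->; rewrite mul1g.
- rewrite invg_eq1 !andbT andbb andbC [RHS]andbC.
  by case: eqVneq => //= ->; rewrite mulg1.
- by rewrite eqxx.
- by rewrite !all_cat eu ev.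
Qed.

Lemma all1_exel_rel u : all (pred1 1%g) u -> exel_rel u [::].
Proof.
elim: u => [|g u IHu] /=; first by move=> _; apply: exel_rel_refl.
by case/andP=> /eqP-> /IHu; apply: (exel_rel_cat exel_rel1).
Qed.

Fact exel_unitm x y :
  exel_mul x y = exel_one -> x = exel_one /\ y = exel_one.
Proof.
rewrite -[x]reprK -[y]reprK exel_mul_pi => /exel_piP/exel_rel_all1.
rewrite all_cat => /andP[u1 v1].
by split; apply/exel_piP/all1_exel_rel.
Qed.

HB.instance Definition _ := Choice_isMonomialDef.Build exel
  exel_mulA exel_mul1m exel_mulm1 exel_unitm.

End ExelMonoid.

Section Kpar.
Variables (K : fieldType) (G : groupType).

Definition Kpar : Type := {malg K[exel G]}.
HB.instance Definition _ := GRing.Lalgebra.on Kpar.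

(* monalg provides the algebra structure for commutative monoids only. *)
Fact Kpar_scalerAr (c : K) (x y : Kpar) : c *: (x * y) = x * (c *: y).
Proof.
rewrite -!mul_malgC !mulrA; congr (_ * y).
rewrite (monalgE x) big_distrr big_distrl /=; apply: eq_bigr => u _.
by rewrite !malgM_def !fgmulUU mul1m mulm1 mulrC.
Qed.
HB.instance Definition _ := GRing.Lalgebra_isAlgebra.Build K Kpar Kpar_scalerAr.

End Kpar.

Record partial_rep (K : fieldType) (G : groupType) (B : algType K) :=
  PartialRep {
  prep_fun :> G -> B;
  prep1 : prep_fun 1%g = 1;
  prepMr (g h : G) :
    prep_fun g * prep_fun h * prep_fun h^-1%g
      = prep_fun (g * h)%g * prep_fun h^-1%g;
  prepMl (g h : G) :
    prep_fun g^-1%g * prep_fun g * prep_fun h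
      = prep_fun g^-1%g * prep_fun (g * h)%g
}.

Definition prep_eps (K : fieldType) (G : groupType) (B : algType K)
  (pi : partial_rep G B) (g : G) : B := pi g * pi g^-1%g.

Section CanonicalRep.
Variables (K : fieldType) (G : groupType).

Definition Kpar_gen (g : G) : Kpar K G := << exel_gen g >>.

Let KparM (x y : exel G) : (<< x >> : Kpar K G) * << y >> = << exel_mul x y >>.
Proof. by rewrite malgM_def fgmulUU mulr1. Qed.

Fact Kpar_gen1 : Kpar_gen 1%g = 1.
Proof. by congr (<< _ >>); apply/exel_piP/exel_rel1. Qed.

Fact Kpar_genMr (g h : G) :
  Kpar_gen g * Kpar_gen h * Kpar_gen h^-1%g
    = Kpar_gen (g * h)%g * Kpar_gen h^-1%g.
Proof.
rewrite /Kpar_gen !KparM; congr (<< _ >>); rewrite /exel_gen !exel_mul_pi.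
exact/exel_piP/exel_relM.
Qed.

Fact Kpar_genMl (g h : G) :
  Kpar_gen g^-1%g * Kpar_gen g * Kpar_gen h
    = Kpar_gen g^-1%g * Kpar_gen (g * h)%g.
Proof.
rewrite /Kpar_gen !KparM; congr (<< _ >>); rewrite /exel_gen !exel_mul_pi.
exact/exel_piP/exel_relV.
Qed.

Definition Kpar_rep : partial_rep G (Kpar K G) :=
  PartialRep Kpar_gen1 Kpar_genMr Kpar_genMl.

End CanonicalRep.

(* Generated unital subalgebra. For the idempotents of a partial representation
   the unit is no addition, since 1 = pi 1 * pi 1 is one of them. *)
Section GeneratedSubalgebra.
Variables (K : fieldType) (B : algType K) (S : set B).

Definition gen_subalg : {pred B} := fun x =>
  `[< forall P : {pred B}, GRing.subalg_closed P ->
        (forall s, S s -> s \in P) -> x \in P >].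

Fact gen_subalg_closed : GRing.subalg_closed gen_subalg.
Proof.
split=> [|a x y /asboolP xS /asboolP yS|x y /asboolP xS /asboolP yS];
  apply/asboolP => P cP SP; have [P1 PD PM] := cP.
- by [].
- by apply: PD; [exact: xS|exact: yS].
- by apply: PM; [exact: xS|exact: yS].
Qed.

Lemma gen_subalg_sub s : S s -> s \in gen_subalg.
Proof. by move=> Ss; apply/asboolP=> P _; apply. Qed.

Lemma gen_subalg_ind (Q : B -> Prop) :
    Q 1 -> (forall a x y, Q x -> Q y -> Q (a *: x + y)) ->
    (forall x y, Q x -> Q y -> Q (x * y)) -> (forall s, S s -> Q s) ->
  forall x, x \in gen_subalg -> Q x.
Proof.
move=> Q1 QD QM QS x /asboolP/(_ (fun x => `[< Q x >])) xQ.
apply/asboolP/xQ => [|s /QS Qs]; last exact/asboolP.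
split=> [|a u v /asboolP Qu /asboolP Qv|u v /asboolP Qu /asboolP Qv].
- exact/asboolP.
- by apply/asboolP/QD.
- by apply/asboolP/QM.
Qed.

Record gen_alg := GenAlg { gen_alg_val : B; _ : gen_alg_val \in gen_subalg }.
HB.instance Definition _ := [isSub for gen_alg_val].
HB.instance Definition _ := [Choice of gen_alg by <:].
HB.instance Definition _ := GRing.SubChoice_isSubAlgebra.Build K B gen_subalg
  gen_alg (GRing.subalg_closed_semi gen_subalg_closed).

End GeneratedSubalgebra.

Definition is_ideal (K : fieldType) (A : algType K) (I : set A) :=
  [/\ I 0, forall (k : K) x y, I x -> I y -> I (k *: x + y)
    & forall a x, I x -> I (a * x) /\ I (x * a)].

(* [pact_map g] is a total function, but only its restriction to
   [pact_dom g^-1] is meaningful: it plays no role outside. *)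
Record partial_action (K : fieldType) (G : groupType) (A : algType K) :=
  PartialAction {
  pact_dom : G -> set A;
  pact_map : G -> A -> A;
  pact_ideal g : is_ideal (pact_dom g);
  pact_bij g : set_bij (pact_dom g^-1%g) (pact_dom g) (pact_map g);
  pact_linear g (k : K) x y : pact_dom g^-1%g x -> pact_dom g^-1%g y ->
    pact_map g (k *: x + y) = k *: pact_map g x + pact_map g y;
  pact_mul g x y : pact_dom g^-1%g x -> pact_dom g^-1%g y ->
    pact_map g (x * y) = pact_map g x * pact_map g y;
  pact_dom1 : pact_dom 1%g = setT;
  pact_map1 x : pact_map 1%g x = x;
  pact_domM g h :
    pact_dom h^-1%g `&` pact_map h @^-1` (pact_dom h `&` pact_dom g^-1%g)
      `<=` pact_dom (g * h)^-1%g;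
  pact_mapM g h x :
    (pact_dom h^-1%g `&` pact_map h @^-1` (pact_dom h `&` pact_dom g^-1%g)) x ->
    pact_map g (pact_map h x) = pact_map (g * h)%g x
}.

Section SkewGroupRing.
Variables (K : fieldType) (G : groupType) (A : algType K).
Variable alpha : partial_action G A.
Local Notation D := (pact_dom alpha).

Implicit Types x y : {malg A[G]}.

(* The finite formal sum \sum_g a_g delta_g is the element of {malg A[G]}
   with coefficients a_g. *)
Definition skew_pred : {pred {malg A[G]}} := fun x =>
  `[< forall g, D g (x@_g) >].

Fact skew_pred_closed : GRing.zmod_closed skew_pred.
Proof.
split=> [|x y /asboolP xD /asboolP yD]; apply/asboolP => g.
  by rewrite mcoeff0; case: (pact_ideal alpha g).
rewrite mcoeffB addrC -scaleN1r.
by case: (pact_ideal alpha g) => _ + _; apply.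
Qed.

Record skew_ring :=
  SkewRing { skew_val : {malg A[G]}; _ : skew_val \in skew_pred }.
HB.instance Definition _ := [isSub for skew_val].
HB.instance Definition _ := [Choice of skew_ring by <:].
HB.instance Definition _ := GRing.SubChoice_isSubZmodule.Build {malg A[G]}
  skew_pred skew_ring skew_pred_closed.

Implicit Types s t : skew_ring.

Lemma skew_coefP s g : D g ((skew_val s)@_g).
Proof. by case: s => x /= /asboolP. Qed.

Lemma skewP s t : (forall g, (skew_val s)@_g = (skew_val t)@_g) -> s = t.
Proof. by move=> /malgP/val_inj. Qed.

(* [{malg A[G]}] only comes with its left A-module structure; the K-module
   structure is recovered through k%:A, see [skew_scaleE]. *)
Fact skew_scale_subproof (k : K) s : k%:A *: skew_val s \in skew_pred.
Proof.
apply/asboolP => g; rewrite mcoeffZ -scalerAl mul1r -[_ *: _]addr0.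
case: (pact_ideal alpha g) => D0 DD _.
by apply: DD => //; apply: skew_coefP.
Qed.

Definition skew_scale (k : K) s := SkewRing (skew_scale_subproof k s).

Lemma skew_scaleE k s g :
  (skew_val (skew_scale k s))@_g = k *: (skew_val s)@_g.
Proof. by rewrite mcoeffZ -scalerAl mul1r. Qed.

Fact skew_scaleA k l s : skew_scale k (skew_scale l s) = skew_scale (k * l) s.
Proof. by apply: skewP => g; rewrite !skew_scaleE scalerA. Qed.

Fact skew_scale1 : left_id 1 skew_scale.
Proof. by move=> s; apply: skewP => g; rewrite !skew_scaleE scale1r. Qed.

Fact skew_scaleDr : right_distributive skew_scale +%R.
Proof.
move=> k s t; apply: skewP => g.
by rewrite mcoeffD !skew_scaleE mcoeffD scalerDr.
Qed.

Fact skew_scaleDl s : {morph skew_scale^~ s : k l / k + l}.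
Proof.
by move=> k l; apply: skewP => g; rewrite mcoeffD !skew_scaleE scalerDl.
Qed.

HB.instance Definition _ := GRing.Zmodule_isLmodule.Build K skew_ring
  skew_scaleA skew_scale1 skew_scaleDr skew_scaleDl.

Definition skew_mul_val x y : {malg A[G]} :=
  \sum_(g <- msupp x) \sum_(h <- msupp y)
    << pact_map alpha g (pact_map alpha g^-1%g (x@_g) * y@_h) *g (g * h)%g >>.

Lemma pact_mapV g (a : A) : D g a ->
  D g^-1%g (pact_map alpha g^-1%g a) /\
  pact_map alpha g (pact_map alpha g^-1%g a) = a.
Proof.
move=> Da; have [DV _ _] := pact_bij alpha g^-1%g.
have Va : D g^-1%g (pact_map alpha g^-1%g a) by apply: DV; rewrite /= invgK.
split=> //; rewrite pact_mapM ?mulgV ?pact_map1 //.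
by split; rewrite ?invgK.
Qed.

Lemma pact_domV g h (a : A) :
  D g^-1%g a -> D h a -> D (g * h)%g (pact_map alpha g a).
Proof.
move=> Da Dha; rewrite -[(g * h)%g]invgK invgM; apply: pact_domM.
rewrite !invgK; have [Dg _ _] := pact_bij alpha g.
split; first exact: Dg.
by have := @pact_mapV g^-1%g a Da; rewrite !invgK => -[_ /= ->].
Qed.

Fact skew_mul_subproof s t :
  skew_mul_val (skew_val s) (skew_val t) \in skew_pred.
Proof.
have [D0 DD] := skew_pred_closed.
have DA u v : u \in skew_pred -> v \in skew_pred -> u + v \in skew_pred.
  by move=> Du Dv; rewrite -[v]opprK DD // -sub0r DD.
rewrite /skew_mul_val; elim/big_ind: _ => // g _.
elim/big_ind: _ => // h _.
apply/asboolP => k; rewrite mcoeffU.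
have [<-|_] := eqVneq; last by case: (pact_ideal alpha k).
have [Dg _] := pact_mapV (skew_coefP s g).
apply: pact_domV.
- by have [_ _ I] := pact_ideal alpha g^-1%g; exact: (I _ _ Dg).2.
- by have [_ _ I] := pact_ideal alpha h; exact: (I _ _ (skew_coefP t h)).1.
Qed.

(* The multiplication need not be associative for a general partial action, so
   that no ring structure is declared on [skew_ring]. *)
Definition skew_mul s t : skew_ring := SkewRing (skew_mul_subproof s t).

Fact skew_one_subproof : << 1 *g 1%g >> \in skew_pred.
Proof.
apply/asboolP => g; rewrite mcoeffU; have [<-|_] := eqVneq.
  by rewrite pact_dom1.
by case: (pact_ideal alpha g).
Qed.

Definition skew_one : skew_ring := SkewRing skew_one_subproof.

End SkewGroupRing.

Notation prep_alg pi := (gen_alg (range (prep_eps pi))).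

Section AssociatedAction.
Variables (K : fieldType) (G : groupType) (B : algType K).
Variable pi : partial_rep G B.
Local Notation eps := (prep_eps pi).
Local Notation prep_alg := (prep_alg pi).

Definition prep_eps_alg (g : G) : prep_alg :=
  GenAlg (gen_subalg_sub (imageT eps g)).

Lemma eps_prep g : eps g * pi g = pi g.
Proof.
rewrite /prep_eps; have := prepMr pi g g^-1%g.
by rewrite invgK mulgV prep1 mul1r.
Qed.

Lemma prep_epsV g : pi g * eps g^-1%g = pi g.
Proof. by rewrite /prep_eps invgK mulrA eps_prep. Qed.

Lemma prep_eps_idem g : eps g * eps g = eps g.
Proof. by rewrite {2 3}/prep_eps mulrA eps_prep. Qed.

Lemma prep_epsM g h : pi g * eps h = eps (g * h)%g * pi g.
Proof.
rewrite /prep_eps mulrA prepMr -[in LHS]eps_prep /prep_eps -!mulrA.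
have := prepMl pi (g * h)%g h^-1%g; rewrite -!mulrA mulgK => ->.
by [].
Qed.

Lemma prep_eps_comm g h : eps g * eps h = eps h * eps g.
Proof.
by rewrite {1}/prep_eps -mulrA prep_epsM mulrA prep_epsM mulVKg -mulrA.
Qed.

Lemma prep_alg_comm (a : prep_alg) g : val a * eps g = eps g * val a.
Proof.
case: a => x /= xA.
elim/gen_subalg_ind: xA => [|k u v eu ev|u v eu ev|_ [h _ <-]].
- by rewrite mul1r mulr1.
- by rewrite mulrDl mulrDr -scalerAl -scalerAr eu ev.
- by rewrite -mulrA ev mulrA eu mulrA.
- exact: prep_eps_comm.
Qed.

Lemma prep_conj_subproof g (a : prep_alg) :
  pi g * val a * pi g^-1%g \in gen_subalg (range eps).
Proof.
have [_ _ MA] := gen_subalg_closed (range eps).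
case: a => x /= xA.
suff [y yA ->] : exists2 y, y \in gen_subalg (range eps) & pi g * x = y * pi g.
  by rewrite -mulrA MA // (gen_subalg_sub (imageT eps g)).
have [A1 AD _] := gen_subalg_closed (range eps).
elim/gen_subalg_ind: xA => [|k u v [u' Au eu] [v' Av ev]
    |u v [u' Au eu] [v' Av ev]|_ [h _ <-]].
- by exists 1; rewrite ?mul1r ?mulr1.
- exists (k *: u' + v'); first exact: AD.
  by rewrite mulrDl mulrDr -scalerAl -scalerAr eu ev.
- by exists (u' * v'); [exact: MA|rewrite mulrA eu -mulrA ev mulrA].
- exists (eps (g * h)%g); last exact: prep_epsM.
  exact: gen_subalg_sub (imageT eps _).
Qed.

Definition prep_conj (g : G) (a : prep_alg) : prep_alg :=
  GenAlg (prep_conj_subproof g a).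

Definition prep_dom (g : G) : set prep_alg :=
  [set prep_eps_alg g * a | a in setT].

Lemma prep_domP g a : prep_dom g a <-> eps g * val a = val a.
Proof.
split=> [[b _ <-]|ea]; first by rewrite /= mulrA prep_eps_idem.
by exists a => //; apply: val_inj.
Qed.

Lemma prep_conjK g a :
  prep_dom g^-1%g a -> prep_conj g^-1%g (prep_conj g a) = a.
Proof.
move=> /prep_domP; rewrite /prep_eps invgK => ea; apply: val_inj => /=.
rewrite invgK !mulrA ea -mulrA.
have := prep_alg_comm a g^-1%g; rewrite /prep_eps invgK => ->.
exact: ea.
Qed.

Fact prep_dom_ideal g : is_ideal (prep_dom g).
Proof.
split=> [|k a b /prep_domP ea /prep_domP eb|a b /prep_domP eb].
- by apply/prep_domP; rewrite /= mulr0.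
- by apply/prep_domP; rewrite /= mulrDr -scalerAr ea eb.
- by split; apply/prep_domP; rewrite /= mulrA ?eb // -prep_alg_comm -mulrA eb.
Qed.

Fact prep_conj_bij g : set_bij (prep_dom g^-1%g) (prep_dom g) (prep_conj g).
Proof.
have fD h a : prep_dom h (prep_conj h a).
  by apply/prep_domP; rewrite /= !mulrA eps_prep.
split=> [a _|a b|a Da]; first exact: fD.
  by move=> /set_mem/prep_conjK {2}<- /set_mem/prep_conjK {2}<- ->.
exists (prep_conj g^-1%g a); first exact: fD.
by have := @prep_conjK g^-1%g a; rewrite invgK; apply.
Qed.

Fact prep_conj_linear g (k : K) (a b : prep_alg) :
  prep_dom g^-1%g a -> prep_dom g^-1%g b ->
  prep_conj g (k *: a + b) = k *: prep_conj g a + prep_conj g b.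
Proof.
by move=> _ _; apply: val_inj; rewrite /= mulrDr mulrDl -scalerAr -scalerAl.
Qed.

Fact prep_conj_mul g (a b : prep_alg) :
  prep_dom g^-1%g a -> prep_dom g^-1%g b ->
  prep_conj g (a * b) = prep_conj g a * prep_conj g b.
Proof.
move=> _ /prep_domP; rewrite /prep_eps invgK => eb; apply: val_inj => /=.
by rewrite -{1}eb !mulrA.
Qed.

Fact prep_dom1 : prep_dom 1%g = setT.
Proof.
apply/seteqP; split=> // a _; apply/prep_domP.
by rewrite /prep_eps invg1 prep1 !mul1r.
Qed.

Fact prep_conj1 a : prep_conj 1%g a = a.
Proof. by apply: val_inj; rewrite /= invg1 prep1 mul1r mulr1. Qed.

Fact prep_domM g h :
  prep_dom h^-1%g `&` prep_conj h @^-1` (prep_dom h `&` prep_dom g^-1%g)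
    `<=` prep_dom (g * h)^-1%g.
Proof.
move=> a [/prep_conjK ha [_ /prep_domP]]; rewrite -[in X in _ -> X]ha.
move: (prep_conj h a) => b eb; apply/prep_domP.
by rewrite invgM /= !mulrA -prep_epsM -(mulrA (pi _)) eb.
Qed.

Fact prep_conjM g h a :
  (prep_dom h^-1%g `&` prep_conj h @^-1` (prep_dom h `&` prep_dom g^-1%g)) a ->
  prep_conj g (prep_conj h a) = prep_conj (g * h)%g a.
Proof.
move=> [/prep_domP ea _]; apply: val_inj; rewrite /= invgM.
have ae : val a * (pi h^-1%g * pi h) = val a.
  by have := prep_alg_comm a h^-1%g; rewrite ea /prep_eps invgK.
have gh : pi g * pi h = pi (g * h)%g * (pi h^-1%g * pi h).
  by have := prepMr pi (g * h)%g h^-1%g; rewrite invgK mulgK mulrA.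
have hg : pi h^-1%g * pi g^-1%g = pi h^-1%g * pi h * pi (h^-1 * g^-1)%g.
  by rewrite prepMl mulVKg.
have {}ea : pi h^-1%g * pi h * val a = val a by rewrite -{2}ea /prep_eps invgK.
transitivity (pi g * pi h * val a * (pi h^-1%g * pi g^-1%g)).
  by rewrite !mulrA.
by rewrite hg gh -(mulrA (pi (g * h)%g)) ea mulrA -(mulrA _ (val a)) ae.
Qed.

Definition assoc_action : partial_action G prep_alg :=
  PartialAction prep_dom_ideal prep_conj_bij prep_conj_linear prep_conj_mul
    prep_dom1 prep_conj1 prep_domM prep_conjM.

Definition prep_phi (s : skew_ring assoc_action) : B :=
  \sum_(g <- msupp (skew_val s)) val ((skew_val s)@_g) * pi g.

End AssociatedAction.

(* Main.v *)
Require Import Defs.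
From mathcomp Require Import all_boot all_algebra.
From mathcomp Require Import boolp classical_sets functions.
From mathcomp Require Import finmap monalg.

Set Implicit Arguments.
Unset Strict Implicit.
Unset Printing Implicit Defensive.

Import GRing.Theory.
Local Open Scope ring_scope.

(* Surjectivity holds because the range of phi is a subalgebra containing
   [g] = phi (eps_g delta_g) for every g. For injectivity, the defining
   relations of S(G) preserve the product in G of a word, so K_par(G) is
   G-graded with A in degree 1 and [g] in degree g. Hence
   phi (\sum_g a_g delta_g) = 0 forces a_g [g] = 0 for each g, and then
   a_g = a_g eps_g = a_g [g] [g^-1] = 0. *)

Section AssociatedMorphism.
Variables (K : fieldType) (G : groupType) (B : algType K).
Variable pi : partial_rep G B.
Local Notation eps := (prep_eps pi).
Local Notation alpha := (assoc_action pi).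
Implicit Types s t : skew_ring alpha.

(** Gives access to the additivity of [mmap] and to its values on monomials. *)
Lemma prep_phiE s : prep_phi s = mmap val pi (skew_val s).
Proof. by []. Qed.

Lemma prep_phi_linear : linear (@prep_phi _ _ _ pi).
Proof.
move=> k s t; rewrite !prep_phiE.
rewrite [skew_val _]/(skew_val (skew_scale k s) + skew_val t).
rewrite mmapD; congr (_ + _).
(* Scaling by [k] can shrink the support, so the sum is extended to the support of [s]. *)
rewrite (mmapEw (g := skew_val (skew_scale k s)) (msuppZ_le _ _)).
rewrite scaler_sumr; apply: eq_bigr => g _.
by rewrite skew_scaleE /= scalerAl.
Qed.

Lemma prep_coef_eps s g : val (skew_val s)@_g * eps g = val (skew_val s)@_g.
Proof. by rewrite prep_alg_comm; apply/prep_domP/(skew_coefP s). Qed.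

Lemma prep_coef_inj s t g :
  val (skew_val s)@_g * pi g = val (skew_val t)@_g * pi g ->
  (skew_val s)@_g = (skew_val t)@_g.
Proof.
move=> st; apply: val_inj; rewrite -(prep_coef_eps s g) -(prep_coef_eps t g).
by rewrite /prep_eps [LHS]mulrA [RHS]mulrA st.
Qed.

(** Termwise, with a = a_g and b = b_h, the left side is pi(g) pi(g^-1) a pi(g) b pi(g^-1) pi(gh).
    The leading eps_g is absorbed by a, and pi(g^-1) pi(gh) = eps_(g^-1) pi(h). This idempotent
    commutes with b and is absorbed by pi(g). *)
Lemma prep_phi_mul : {morph @prep_phi _ _ _ pi : s t / skew_mul s t >-> s * t}.
Proof.
move=> s t; rewrite prep_phiE [skew_val _]/(skew_mul_val _ _ _).
rewrite raddf_sum big_distrl.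
apply: eq_bigr => g _; rewrite raddf_sum big_distrr; apply: eq_bigr => h _.
rewrite [LHS]mmapU /= invgK; set a := val (skew_val s)@_g.
set b := (skew_val t)@_h.
have agE : pi g * (pi g^-1%g * a * pi g) = a * pi g.
  by rewrite !mulrA -/(eps g) -prep_alg_comm prep_coef_eps.
transitivity (a * pi g * (val b * eps g^-1%g) * pi h).
  rewrite -{}agE /prep_eps invgK -!mulrA; do 5 congr (_ * _).
  by have := prepMl pi g h; rewrite -!mulrA => ->.
by rewrite prep_alg_comm -!(mulrA a) (mulrA (pi g) (eps _)) prep_epsV !mulrA.
Qed.

Lemma prep_phi_one : prep_phi (skew_one alpha) = 1.
Proof. by rewrite prep_phiE mmapU /= prep1 mulr1. Qed.

Lemma prep_eps_delta_subproof g :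
  << prep_eps_alg pi g *g g >> \in skew_pred alpha.
Proof.
apply/asboolP => h; rewrite mcoeffU; have [<-|_] := eqVneq.
  by apply/prep_domP; rewrite /= prep_eps_idem.
by case: (pact_ideal alpha h).
Qed.

Lemma prep_phi_gen g : prep_phi (SkewRing (prep_eps_delta_subproof g)) = pi g.
Proof. by rewrite prep_phiE mmapU /= eps_prep. Qed.

End AssociatedMorphism.

Section Grading.
Variables (K : fieldType) (G : groupType).
Local Notation pi := (Kpar_rep K G).
Implicit Types (x y : exel G) (u v : Kpar K G).

Definition word_deg (w : seq G) : G := foldr (fun g h => g * h)%g 1%g w.

Lemma word_deg_cat w1 w2 :
  word_deg (w1 ++ w2) = (word_deg w1 * word_deg w2)%g.
Proof. by elim: w1 => [|g w IHw] /=; rewrite ?mul1g // IHw mulgA. Qed.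

Lemma word_deg_rel w1 w2 : exel_rel w1 w2 -> word_deg w1 = word_deg w2.
Proof.
elim=> {w1 w2} [g h|g h||w1 w1' w2 w2' _ e1 _ e2|//|//|w1 w2 w3 _ -> //] /=.
- by rewrite !mulg1.
- by rewrite !mulgA.
- by rewrite mulg1.
- by rewrite !word_deg_cat e1 e2.
Qed.

(** The homomorphism from S(G) to G with [g] sent to g. By [word_deg_rel] the representative picked
    by [repr] is immaterial. *)
Definition exel_deg x : G := word_deg (repr x).

Lemma exel_deg_pi w : exel_deg (\pi_(exel G)%qT w) = word_deg w.
Proof. by apply/word_deg_rel/exel_piP; rewrite reprK. Qed.

Lemma exel_degM x y : exel_deg (exel_mul x y) = (exel_deg x * exel_deg y)%g.
Proof. by rewrite exel_deg_pi word_deg_cat. Qed.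

(** Zero is homogeneous of every degree. *)
Definition homogeneous (g : G) u :=
  forall x, x \in msupp u -> exel_deg x = g.

Lemma homogeneous_outdom g u x :
  homogeneous g u -> exel_deg x != g -> u@_x = 0.
Proof. by move=> hu xg; apply: mcoeff_outdom; apply: contraNN xg => /hu->. Qed.

Lemma homogeneousM g h u v :
  homogeneous g u -> homogeneous h v -> homogeneous (g * h)%g (u * v).
Proof.
move=> hu hv x /msuppM_le[y [z [/hu <- /hv <- ->]]]; exact: exel_degM.
Qed.

Lemma homogeneous_gen g : homogeneous g (pi g).
Proof.
by move=> x; rewrite msuppU1 inE => /eqP->; rewrite exel_deg_pi /= mulg1.
Qed.

(** The generators [g][g^-1] have degree g g^-1 = 1, and the elements of degree 1 form a unital
    subalgebra. *)
Lemma homogeneous_eps_alg u :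
  u \in gen_subalg (range (prep_eps pi)) -> homogeneous 1%g u.
Proof.
elim/gen_subalg_ind => [|k a b ha hb|a b ha hb|_ [g _ <-]].
- by rewrite -(prep1 pi); apply: homogeneous_gen.
- move=> x /(fsubsetP (msuppD_le _ _)); rewrite inE => /orP[|/hb//].
  by move/(fsubsetP (msuppZ_le _ _))/ha.
- by rewrite -(mulg1 1%g); apply: homogeneousM.
- by rewrite -(mulgV g); apply: homogeneousM; apply: homogeneous_gen.
Qed.

Lemma prep_phi_homogeneous (s : skew_ring (assoc_action pi)) g :
  homogeneous g (val (skew_val s)@_g * pi g).
Proof.
rewrite -[X in homogeneous X](mul1g g); apply: homogeneousM.
  exact/homogeneous_eps_alg/(valP (skew_val s)@_g).
exact: homogeneous_gen.
Qed.

Lemma mcoeff_prep_phi (s : skew_ring (assoc_action pi)) x :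
  (prep_phi s)@_x =
    (val (skew_val s)@_(exel_deg x) * pi (exel_deg x) : Kpar K G)@_x.
Proof.
set g := exel_deg x.
(* Adjoining [g] to the support lets its summand be split off even when a_g = 0. The other summands
   have degree different from [exel_deg x], hence no coefficient at [x]. *)
rewrite prep_phiE (mmapEw (fsubsetUr [fset g]%fset _)).
rewrite raddf_sum (big_fsetD1 g) ?inE ?eqxx //= big1_fset ?addr0 // => h.
rewrite in_fsetD1 => /andP[hg _] _.
by apply: (homogeneous_outdom (@prep_phi_homogeneous s h)); rewrite eq_sym.
Qed.

Lemma prep_phi_inj : injective (@prep_phi _ _ _ pi).
Proof.
move=> s t est; apply: skewP => g; apply/(@prep_coef_inj _ _ _ pi)/malgP => x.
(* In degree [g] the coefficient is read off the common image; in any other degree both sides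
   vanish. *)
have [<-|xg] := eqVneq (exel_deg x) g.
  by apply: etrans (mcoeff_prep_phi t x); rewrite -est mcoeff_prep_phi.
apply: etrans (homogeneous_outdom (@prep_phi_homogeneous s g) xg) _.
exact/esym/(homogeneous_outdom (@prep_phi_homogeneous t g) xg).
Qed.

(** Induction on a word for [x]: prepending the letter g amounts to multiplying the preimage on the
    left by eps_g delta_g. *)
Lemma prep_phi_monomial x :
  exists s : skew_ring (assoc_action pi), prep_phi s = << x >>.
Proof.
rewrite -[x]reprK; elim: (repr x) => [|g w [t tE]].
  by exists (skew_one _); apply: prep_phi_one.
exists (skew_mul (SkewRing (prep_eps_delta_subproof pi g)) t).
rewrite prep_phi_mul prep_phi_gen tE malgM_def fgmulUU mulr1.
by congr (<< _ >>); apply: exel_mul_pi.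
Qed.

Lemma prep_phi_surj u : exists s : skew_ring (assoc_action pi), prep_phi s = u.
Proof.
rewrite (monalgE u); elim/big_rec: _ => [|x _ _ [t <-]].
  by exists 0; rewrite prep_phiE raddf0.
have [s sE] := prep_phi_monomial x.
exists (u@_x *: s + t); rewrite prep_phi_linear sE; congr (_ + _).
by apply/malgP => y; rewrite mcoeffZ !mcoeffU mulrnAr mulr1.
Qed.

End Grading.

Theorem theorem6p9 (G : groupType) (K : fieldType) :
  let alpha : partial_action G (prep_alg (Kpar_rep K G)) :=
    assoc_action (Kpar_rep K G) in
  let phi : skew_ring alpha -> Kpar K G := @prep_phi _ _ _ (Kpar_rep K G) in
  [/\ linear phi,
      {morph phi : x y / skew_mul x y >-> x * y},
      phi (skew_one alpha) = 1
    & bijective phi].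
Proof.
split; [exact: prep_phi_linear|exact: prep_phi_mul|exact: prep_phi_one|].
rewrite -setTT_bijective; split=> // [s t _ _|u _]; first exact: prep_phi_inj.
by have [s <-] := prep_phi_surj u; exists s.
Qed.
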